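(* Let $k\ge 2$ be an integer. Then $C_k = A_1\cup A_2\cup A_3\cup A_4\cup A_5$, where (1) $A_1=\{2x : x\in C_{k-1},\ x \text{ even}\}$; (2) $A_2=\{3x : x\in C_{k-1},\ x\text{ odd}\}$; (3) $A_3=\{px : 2\le k_1\le k-1,\ x\in C_{k-k_1},\ p\in Q_{k_1+1}\}$; (4) $A_4=\{m+1 : m\in C_{k-1},\ m \text{ even},\ m+1 \text{ prime}\}$; (5) $A_5=\{2y : y\in A_1\cup A_2\cup A_3\cup A_4,\ y\text{ odd}\}$.
   Context: Let $\varphi$ be Euler's totient function. The height function $H:\mathbb{Z}_{>0}\to\mathbb{Z}_{\ge 0}$ is defined by $H(1)=0$ and $H(n)=H(\varphi(n))+1$ for $n\ge 2$ (equivalently, for $n>1$, $H(n)$ is the least $i$ with the $i$-th iterate of $\varphi$ at $n$ equal to $1$). For $k\ge 0$ let $C_k=\{n\ge 1 : H(n)=k\}$, and for $k\ge 1$ let $Q_k=\{p \text{ prime} : H(p)=k\}$. *)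

(* Defs.v *)
From mathcomp Require Import all_boot.
From mathcomp Require Import boolp classical_sets.

Set Implicit Arguments.
Unset Strict Implicit.
Unset Printing Implicit Defensive.

Local Open Scope classical_set_scope.
Local Open Scope nat_scope.

(* Fuel-bounded recursion for H; since totient n < n for n > 1, fuel n suffices
   (heightE shows that the recursion equation of H holds).  The value 0 at the
   argument 0, outside the domain of H, is irrelevant. *)
Fixpoint height_rec (fuel n : nat) : nat :=
  if fuel is fuel'.+1 then
    if n <= 1 then 0 else (height_rec fuel' (totient n)).+1
  else 0.

Definition height (n : nat) : nat := height_rec n n.

Lemma totient_ltn n : 1 < n -> totient n < n.
Proof.
case: n => // n n_gt0; rewrite totient_count_coprime big_mkord big_ord_recl /=.
rewrite /coprime gcdn0 eqn_leq [_.+1 <= 1]leqNgt n_gt0 /= add0n ltnS.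
rewrite -[leqRHS]card_ord -sum1_card; apply: leq_sum => i _; exact: leq_b1.
Qed.

Lemma height_rec_fuel f1 f2 n : n <= f1 -> n <= f2 ->
  height_rec f1 n = height_rec f2 n.
Proof.
elim: f1 f2 n => [|f1 IH] [|f2] n //=; try by case: n => // -[].
case: (leqP n 1) => // n_gt1 le1 le2; congr _.+1.
by apply: IH; rewrite -ltnS; apply: leq_trans (totient_ltn n_gt1) _.
Qed.

Lemma height1 : height 1 = 0.
Proof. by []. Qed.

Lemma heightE n : 2 <= n -> height n = (height (totient n)).+1.
Proof.
case: n => // n n_ge2; rewrite {1}/height /= leqNgt n_ge2 /=; congr _.+1.
by apply: height_rec_fuel => //; rewrite -ltnS totient_ltn.
Qed.

Definition C (k : nat) : set nat := [set n | 1 <= n /\ height n = k].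

Definition Q (k : nat) : set nat := [set p | prime p /\ height p = k].

Definition A1 (k : nat) : set nat :=
  [set n | exists x, [/\ C (k - 1) x, ~~ odd x & n = 2 * x]].

Definition A2 (k : nat) : set nat :=
  [set n | exists x, [/\ C (k - 1) x, odd x & n = 3 * x]].

Definition A3 (k : nat) : set nat :=
  [set n | exists k1 x p,
    [/\ 2 <= k1 <= k - 1, C (k - k1) x, Q k1.+1 p & n = p * x]].

Definition A4 (k : nat) : set nat :=
  [set n | exists m, [/\ C (k - 1) m, ~~ odd m, prime m.+1 & n = m.+1]].

Definition A5 (k : nat) : set nat :=
  [set n | exists y,
    [/\ (A1 k `|` A2 k `|` A3 k `|` A4 k) y, odd y & n = 2 * y]].

(* Main.v *)
Require Import Defs.
From mathcomp Require Import all_boot.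
From mathcomp Require Import boolp classical_sets.
From mathcomp Require Import zify.

(** Let [d n], the [log_height] below, be [H n] for even [n] and [H n - 1] for
    odd [n > 1], with [d 1 = 0].  As [totient n] is even for [n > 2], one has
    [d n = d (totient n) + [n is even]] for every [n > 0], and this makes [d]
    completely additive (Shapiro): when a prime [p] does not divide [m],
    [totient (p * m) = (p - 1) * totient m], and otherwise
    [totient (p * m) = p * totient m].  The decomposition of [C k] is then read
    off from the 2-adic valuation of [n] and from a prime factor of its odd
    part. *)

Local Open Scope classical_set_scope.
Local Open Scope nat_scope.

Lemma totient_prime_mul p m : prime p -> 0 < m ->
  totient (p * m) = (if p %| m then p else p.-1) * totient m.
Proof.
move=> p_pr m_gt0; have [pm|/negbTE pm] := boolP (p %| m); last first.
  by rewrite totient_coprime ?prime_coprime ?pm // totient_prime.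
have [n cop_pn mE] := pfactor_coprime p_pr m_gt0.
have e_gt0 : 0 < logn p m by rewrite logn_gt0 mem_primes p_pr m_gt0.
have cop_n e : coprime (p ^ e) n by rewrite coprimeXl.
have totE e : 0 < e -> totient (n * p ^ e) = p.-1 * p ^ e.-1 * totient n.
  by move=> e_gt0'; rewrite mulnC totient_coprime // totient_pfactor.
rewrite mE; case: (logn p m) e_gt0 => // e _.
by rewrite mulnCA -expnS !totE //= expnS; lia.
Qed.

(** Induction by splitting off the least prime factor [p]: a cofactor above 2 already has even
    totient. Otherwise the new factor is even, being 2 when [n] is 4 and [p.-1] when [p] is odd. *)
Lemma totient_even n : 2 < n -> ~~ odd (totient n).
Proof.
elim/ltn_ind: n => n IH n_gt2.
have p_pr : prime (pdiv n) by rewrite pdiv_prime; lia.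
have /dvdnP [m nE] := pdiv_dvd n.
set p := pdiv n in p_pr nE.
have m_gt0 : 0 < m by lia.
rewrite nE mulnC totient_prime_mul // oddM.
have p_gt1 := prime_gt1 p_pr.
have [m_le2|m_gt2] := leqP m 2; last first.
  by rewrite (negbTE (IH m _ m_gt2)) ?andbF //; nia.
have [p2|p_odd] := even_prime p_pr.
  have -> : m = 2 by nia.
  by rewrite p2.
have -> : (p %| m) = false by apply/negbTE/negP => /(dvdn_leq m_gt0); lia.
by rewrite -subn1 oddB ?prime_gt0 // p_odd.
Qed.

Lemma height_gt0 n : 1 < n -> 0 < height n.
Proof. by move=> /heightE ->. Qed.

(** Truncated subtraction yields the value 0 at 1. *)
Definition log_height n := height n - odd n.

Lemma log_heightE n : 0 < n ->
  log_height n = log_height (totient n) + ~~ odd n.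
Proof.
rewrite /log_height; case: n => [|[|[|n]]] // _.
have /negbTE ev := totient_even _ (isT : 2 < n.+3).
by rewrite (@heightE n.+3) // ev; lia.
Qed.

Lemma log_heightM m n : 0 < m -> 0 < n ->
  log_height (m * n) = log_height m + log_height n.
Proof.
have [N] := ubnP (m * n); elim: N m n => // N IH m n; rewrite ltnS => le_mn.
(* One prime factor is treated first: passing to totients makes the product drop below [N], so [IH]
   applies. *)
have prime_mul p a : prime p -> 0 < a -> p * a <= N ->
    log_height (p * a) = log_height p + log_height a.
  move=> p_pr a_gt0 le_pa; have p_gt1 := prime_gt1 p_pr.
  have ta_gt0 : 0 < totient a by rewrite totient_gt0.
  have ta_le : totient a <= a.
    by case: a a_gt0 {le_pa ta_gt0} => [|[|a]] // _; apply/ltnW/totient_ltn.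
  rewrite [LHS]log_heightE ?muln_gt0 ?a_gt0 ?prime_gt0 // totient_prime_mul //.
  rewrite (log_heightE a) // oddM.
  have [pa|pa] := boolP (p %| a).
    have [a1|a_gt1] := leqP a 1; first by move: (dvdn_leq a_gt0 pa); lia.
    have ta_lt := totient_ltn a_gt1.
    have lt_pta : p * totient a < N by nia.
    rewrite (IH _ _ lt_pta (prime_gt0 p_pr) ta_gt0).
    (* Both parity terms agree: since [p] divides [a], the product [p * a] is odd exactly when [a]
       is. *)
    suff : odd a -> odd p.
      by move=> odd_ap; case: (odd a) odd_ap => [/(_ isT) ->|]; rewrite ?andbF addnA.
    exact: dvdn_odd.
  have lt_pta : p.-1 * totient a < N by nia.
  rewrite (IH _ _ lt_pta) //; last by lia.
  rewrite (log_heightE p (prime_gt0 p_pr)) (totient_prime p_pr).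
  (* At most one of [p] and [a] is even, so their parity terms add up to that of [p * a]. *)
  have [p2|p_odd] := even_prime p_pr; last by rewrite p_odd addn0 addnA.
  by move: pa; rewrite p2 dvdn2 negbK => ->; rewrite addn0 addnAC.
move=> m_gt0 n_gt0; have [m1|m_gt1] := leqP m 1.
  have -> : m = 1 by lia.
  by rewrite mul1n.
have p_pr := pdiv_prime m_gt1; have /dvdnP [a mE] := pdiv_dvd m.
set p := pdiv m in p_pr mE; have p_gt1 := prime_gt1 p_pr.
have a_gt0 : 0 < a by lia.
have a_lt : a * n < p * (a * n) by rewrite ltn_Pmull // muln_gt0 a_gt0.
have lt_an : a * n < N by nia.
rewrite mE [a * p]mulnC -mulnA (prime_mul p (a * n)) ?muln_gt0 ?a_gt0 //;
  last by nia.
by rewrite (prime_mul p a) ?(IH _ _ lt_an) ?addnA //; nia.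
Qed.

Lemma height_odd_mul m n : odd m -> 1 < m -> 1 < n ->
  height (m * n) = (height m + height n).-1.
Proof.
move=> m_odd m_gt1 n_gt1.
have := log_heightM m n (ltnW m_gt1) (ltnW n_gt1).
have := height_gt0 _ m_gt1; have := height_gt0 _ n_gt1.
have : 0 < height (m * n) by apply: height_gt0; nia.
by rewrite /log_height oddM m_odd /=; case: (odd n); lia.
Qed.

Lemma height_double_even n : 0 < n -> ~~ odd n -> height (2 * n) = (height n).+1.
Proof.
move=> n_gt0 /negbTE n_even; have := log_heightM 2 n isT n_gt0.
by rewrite /log_height oddM n_even /= !subn0.
Qed.

Lemma height_double_odd n : 1 < n -> odd n -> height (2 * n) = height n.
Proof.
by move=> n_gt1 n_odd; rewrite mulnC height_odd_mul // addn1.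
Qed.

Lemma height_prime p : prime p -> height p = (height p.-1).+1.
Proof. by move=> p_pr; rewrite heightE ?prime_gt1 // totient_prime. Qed.

(** The totient of [p.-1] is even, hence not 1. This secures the bound [2 <= k1] in [A3]. *)
Lemma height_prime_ge3 p : prime p -> 3 < p -> 3 <= height p.
Proof.
move=> p_pr p_gt3; rewrite height_prime // heightE; last by lia.
rewrite !ltnS height_gt0 // ltn_neqAle totient_gt0 andbC.
have p1_gt2 : 2 < p.-1 by lia.
rewrite (ltnW (ltnW p1_gt2)) /=; apply/eqP => t1.
by have := totient_even _ p1_gt2; rewrite -t1.
Qed.

Lemma C_gt1 k n : 0 < k -> C k n -> 1 < n.
Proof.
move=> k_gt0 [n_gt0 nk]; case: n n_gt0 nk => [|[|n]] // _.
by rewrite height1; lia.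
Qed.

Lemma sub_C k : 2 <= k -> A1 k `|` A2 k `|` A3 k `|` A4 k `<=` C k.
Proof.
move=> k_ge2 n [[[|]|]|].
- move=> [x [[x_gt0 xk] x_even ->]]; split; first by lia.
  by rewrite height_double_even // xk; lia.
- move=> [x [Cx x_odd ->]].
  have x_gt1 : 1 < x by apply: C_gt1 Cx; lia.
  case: Cx => _ xk; split; first by lia.
  rewrite height_odd_mul // xk.
  by have -> : height 3 = 2 by []; lia.
- move=> [k1 [x [p [k1_bnd Cx [p_pr pk] ->]]]].
  have x_gt1 : 1 < x by apply: C_gt1 Cx; lia.
  case: Cx => _ xk; have p_gt1 := prime_gt1 p_pr; split; first by nia.
  (* The prime 2 has height 1, whereas [k1.+1] is at least 3. *)
  have [p2|p_odd] := even_prime p_pr.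
    by move: pk; rewrite p2; have -> : height 2 = 1 by []; lia.
  by rewrite height_odd_mul // xk pk; lia.
- move=> [m [[m_gt0 mk] m_even m_pr ->]]; split=> //.
  by rewrite height_prime //= mk; lia.
Qed.

Lemma odd_C k n : 2 <= k -> C k n -> odd n -> (A2 k `|` A3 k `|` A4 k) n.
Proof.
move=> k_ge2 Cn n_odd.
have n_gt1 : 1 < n by apply: C_gt1 Cn; lia.
case: Cn => n_gt0 nk; have [n_pr|n_comp] := boolP (prime n).
  right; exists n.-1; rewrite prednK //; move: nk; rewrite height_prime // => nk.
  by split=> //; [split; lia|lia].
left; have p_pr := pdiv_prime n_gt1; have /dvdnP [x nE] := pdiv_dvd n.
set p := pdiv n in p_pr nE.
have p_gt1 := prime_gt1 p_pr; rewrite mulnC in nE.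
have x_gt1 : 1 < x.
  case: x nE => [|[|x]] // nE; first by lia.
  by move: n_comp; rewrite nE muln1 p_pr.
have /andP[p_odd x_odd] : odd p && odd x by rewrite -oddM -nE.
move: nk; rewrite nE height_odd_mul //; have x_h := height_gt0 _ x_gt1.
have [p_le3|p_gt3] := leqP p 3.
  have -> : p = 3 by lia.
  have -> : height 3 = 2 by [].
  by move=> xk; left; exists x; split=> //; split; lia.
have p_h := height_prime_ge3 _ p_pr p_gt3.
(* Here [k] is [(height p).-1 + height x], so [height x > 0] keeps the chosen [k1] at most
   [k - 1]. *)
move=> nk; right; exists (height p).-1, x, p.
by split=> //; [lia|split; lia|split=> //; lia].
Qed.

Theorem theorem2p3 (k : nat) (k_ge2 : 2 <= k) :
  C k = A1 k `|` A2 k `|` A3 k `|` A4 k `|` A5 k.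
Proof.
apply/seteqP; split=> [n Cn|n [/(sub_C _ k_ge2) //|]]; last first.
  move=> [y [/(sub_C _ k_ge2) Cy y_odd ->]].
  have y_gt1 : 1 < y by apply: C_gt1 Cy; lia.
  by case: Cy => _ yk; split; [lia|rewrite height_double_odd].
have [n_odd|n_even] := boolP (odd n).
  left; case: (odd_C _ _ k_ge2 Cn n_odd) => [[]|];
    [by left; left; right|by left; right|by right].
have n_gt1 : 1 < n by apply: C_gt1 Cn; lia.
case: Cn => n_gt0 nk.
have /dvdnP [y nE] : 2 %| n by rewrite dvdn2.
rewrite mulnC in nE; have y_gt0 : 0 < y by lia.
(* Doubling an odd [y > 1] preserves the height, which leads to [A5]; doubling an even [y] raises it
   by one, which leads to [A1]. *)
have [y_odd|y_even] := boolP (odd y).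
  have y_gt1 : 1 < y.
    (* For [y = 1] the number [n] is 2, of height 1, against [2 <= k]. *)
    case: y nE {y_gt0 y_odd} => [|[|y]] // nE; first by lia.
    by move: nk; rewrite nE (_ : height _ = 1) //; lia.
  right; exists y; split=> //.
  have Cy : C k y by split; [|rewrite -height_double_odd // -nE].
  by case: (odd_C _ _ k_ge2 Cy y_odd) => [[]|]; [left; left; right|left; right|right].
left; left; left; left; exists y; split=> //; split=> //.
by move: nk; rewrite nE height_double_even //; lia.
Qed.
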